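(* Let $m,M\in\{0.01,0.02,\dots,0.99\}$ with $m\le M$ and $\varepsilon\in\{0,0.01,\dots,1.99,2\}\cup\{2.1,2.2,\dots,10\}\cup\{11,12,\dots,100\}$. For $N\in\mathbb{N}$, $J\subseteq[N]$, $a=(a_1,\dots,a_N)\in[m,M]^N$ and $z=(z_1,\dots,z_N)\in P_a$, let \[ f_{J,N}(a;z)=\Big(e^{\varepsilon}-(e^{\varepsilon}-1)\frac{m+\sum_{i=1}^Na_i}{N+1}\Big)\prod_{i\in J}\frac{N+\frac{a_i}{z_i}}{N+1}\prod_{i\in[N]\setminus J}\frac{N+\frac{1-a_i}{1-z_i}}{N+1}. \] Then \[ \sup_{N\in\mathbb{N}}\max_{J\subseteq[N]}\max_{a\in[m,M]^N}\max_{z\in P_a}f_{J,N}(a;z)\le\max_{p\in[0,1]}\max\{L_1(p),L_2(p)\}, \] where \[ L_1(p)=\big(e^{\varepsilon}-(e^{\varepsilon}-1)(pM+(1-p)m)\big)\exp\Big(p\tfrac{M}{m}+(1-p)\tfrac{1-m}{1-(pM+(1-p)m)}-1\Big), \] \[ L_2(p)=\Big(e^{\varepsilon}-(e^{\varepsilon}-1)\Big(pM+(1-p)\tfrac{(M+m)-pM}{2-p}\Big)\Big)\exp\Big(p\tfrac{M}{m}+(1-p)\tfrac{1-\frac{(M+m)-pM}{2-p}}{1-M}-1\Big). \]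
   Context: $[N]=\{1,\dots,N\}$. For $a\in[m,M]^N$, let $M_i=\frac1N\min\{m+(N-1)M,\ (N-2)(a_i-m)+\sum_{j=1}^Na_j\}$ for $i\in[N]$, and let $P_a$ be the set of $z\in[m,M_1]\times\cdots\times[m,M_N]$ satisfying $\sum_{j=1}^Nz_j\le(2N-2)z_i-(N-2)m$ for every $i\in[N]$. *)

(* Defs.v *)
From HB Require Import structures.
From mathcomp Require Import all_boot all_order all_algebra.
From mathcomp Require Import all_classical all_reals all_analysis.
Set Implicit Arguments. Unset Strict Implicit. Unset Printing Implicit Defensive.
Import Order.TTheory GRing.Theory Num.Theory.
Local Open Scope ring_scope.

Section Defs.
Variable R : realType.

Definition grid_mM (x : R) : Prop :=
  exists k : nat, (1 <= k <= 99)%N /\ x = k%:R / 100.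

Definition grid_eps (x : R) : Prop :=
  (exists k : nat, (k <= 200)%N /\ x = k%:R / 100) \/
  (exists k : nat, (21 <= k <= 100)%N /\ x = k%:R / 10) \/
  (exists k : nat, (11 <= k <= 100)%N /\ x = k%:R).

Definition Mi (N : nat) (m M : R) (a : 'I_N -> R) (i : 'I_N) : R :=
  N%:R^-1 * Num.min (m + (N%:R - 1) * M)
                    ((N%:R - 2) * (a i - m) + \sum_(j < N) a j).

Definition in_Pa (N : nat) (m M : R) (a z : 'I_N -> R) : Prop :=
  (forall i, m <= z i <= Mi m M a i) /\
  (forall i, \sum_(j < N) z j <= (2 * N%:R - 2) * z i - (N%:R - 2) * m).

Definition fJN (eps m : R) (N : nat) (J : {set 'I_N}) (a z : 'I_N -> R) : R :=
  (expR eps - (expR eps - 1) * ((m + \sum_(i < N) a i) / (N%:R + 1))) *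
  (\prod_(i in J) ((N%:R + a i / z i) / (N%:R + 1))) *
  (\prod_(i in ~: J) ((N%:R + (1 - a i) / (1 - z i)) / (N%:R + 1))).

Definition L1 (eps m M p : R) : R :=
  (expR eps - (expR eps - 1) * (p * M + (1 - p) * m)) *
  expR (p * (M / m) + (1 - p) * ((1 - m) / (1 - (p * M + (1 - p) * m))) - 1).

Definition L2 (eps m M p : R) : R :=
  let q := ((M + m) - p * M) / (2 - p) in
  (expR eps - (expR eps - 1) * (p * M + (1 - p) * q)) *
  expR (p * (M / m) + (1 - p) * ((1 - q) / (1 - M)) - 1).

End Defs.

(* Main.v *)
(* Write s = 1 - m, D = M - m, w_i = a_i - m and W = w_1 + ... + w_N. As 1 + x <= e^x,
   the two products are at most the exponential of the sum, divided by N+1, of terms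
   bounded by w_i / m (i in J), resp. (y - w_i) / (s - y) with y <= min(D, w_i + c),
   c = W / N (i not in J).
   Seen as functions of w, these bounds lie below every line passing above the points
   A = (0, c / (s - c)), Q = (D - c, c / (s - D)) and T = (D, D / m), so that the mean
   of the terms is at most the value at c of the upper hull of A, Q, T. The chord AT
   gives L1, the chord QT gives L2, and the chord AQ, relevant for 2c <= D only, is
   dominated by L2(0). It remains to replace c by W / (N+1), using that chordAT(c) / c
   is nonincreasing and, when the hull is steep, that the tilted function
   u |-> (e^eps - (e^eps - 1)(m + u)) e^(g u) is nondecreasing for g >= 1 / (s - D). *)
Require Import Defs.
From HB Require Import structures.
From mathcomp Require Import all_boot all_order all_algebra.
From mathcomp Require Import all_classical all_reals all_analysis.
From mathcomp Require Import ring lra.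
Import Order.TTheory GRing.Theory Num.Theory.
Local Open Scope ring_scope.

(* Height at abscissa c of the chord AT; it is the exponent of L1 at p = c / D. *)
Definition chordAT {R : realType} (s D m c : R) : R :=
  c / m + (D - c) / D * (c / (s - c)).

(* Height at abscissa c of the chord QT; it is the exponent of L2 at p = 2 - D / c. *)
Definition chordQT {R : realType} (s D m c : R) : R :=
  D / m * ((2 * c - D) / c) + (D - c) / (s - D).

(** * Lines above A, Q, T and their upper hull *)

Definition dominating_line {R : realType} (s D m c l k : R) : Prop :=
  [/\ c / (s - c) <= l, c / (s - D) <= l + k * (D - c) & D / m <= l + k * D].

(** The points [w / m] fill the segment from the origin to T. As [(y - w) / (s - y)] increases in
    [y], only [y = min(D, w + c)] matters: it gives a convex arc from A to Q, then a segment from Q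
    down to (D, 0), which is below T. *)
Lemma dominating_lineP {R : realType} (s D m c l k w : R) :
  0 <= c <= D -> D < s -> 0 < m -> dominating_line s D m c l k -> 0 <= w <= D ->
  w / m <= l + k * w /\
  forall y, y <= D -> y <= w + c -> (y - w) / (s - y) <= l + k * w.
Proof.
move=> /andP[c0 cD] Ds m0 [hA hQ hT] /andP[w0 wD].
have A0 : 0 <= c / (s - c) by apply: divr_ge0; lra.
have mV : 0 < m^-1 by rewrite invr_gt0.
have hw : w / m <= l + k * w.
  have [D0|D0] := eqVneq D 0.
    have -> : w = 0 by lra.
    by rewrite mul0r mulr0 addr0; apply: le_trans hA.
  have Dp : 0 < D by rewrite lt_neqAle eq_sym D0; lra.
  rewrite -(ler_pM2l Dp) -subr_ge0.
  have -> : D * (l + k * w) - D * (w / m) =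
    w * (l + k * D - D / m) + (D - w) * l by ring.
  by apply: addr_ge0; apply: mulr_ge0; rewrite ?subr_ge0 //; apply: le_trans hA.
split=> // y yD yw.
have sy : 0 < s - y by lra.
have sD : 0 < s - D by lra.
have [wQ|wQ] := leP w (D - c).
  have sw : 0 < s - w - c by lra.
  have h1 : (y - w) / (s - y) <= c / (s - w - c).
    rewrite ler_pdivrMr // mulrAC ler_pdivlMr // -subr_ge0.
    have -> : c * (s - y) - (y - w) * (s - w - c) = (w + c - y) * (s - w) by ring.
    by apply: mulr_ge0; lra.
  apply: (le_trans h1).
  have [E0|E0] := eqVneq (D - c) 0.
    have -> : w = 0 by lra.
    by rewrite mulr0 subr0 addr0.
  have Ep : 0 < D - c by rewrite lt_neqAle eq_sym E0; lra.
  (* on [0, D - c], the convex function c / (s - w - c) lies below the chord AQ *)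
  have h2 : c / (s - w - c) <= c / (s - c) + w * (c / ((s - c) * (s - D))).
    have -> : c / (s - w - c) = c / (s - c) + w * (c / ((s - c) * (s - w - c))).
      by field; rewrite !gt_eqF //; lra.
    rewrite lerD2l; apply: ler_wpM2l => //; apply: ler_wpM2l => //.
    by rewrite lef_pV2 ?posrE; [apply: ler_wpM2l; lra| apply: mulr_gt0; lra..].
  have h3 : c / (s - c) + (D - c) * (c / ((s - c) * (s - D))) = c / (s - D).
    by field; rewrite !gt_eqF //; lra.
  apply: (le_trans h2); rewrite -(ler_pM2l Ep) -subr_ge0.
  set sg := c / ((s - c) * (s - D)) in h3 *.
  have -> : (D - c) * (l + k * w) - (D - c) * (c / (s - c) + w * sg) =
      (D - c - w) * (l - c / (s - c)) +
      w * (l + k * (D - c) - (c / (s - c) + (D - c) * sg)) by ring.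
  by rewrite h3; apply: addr_ge0; apply: mulr_ge0; rewrite ?subr_ge0.
have Q0 : 0 <= (D - w) / (s - D) by apply: divr_ge0; lra.
have h1 : (y - w) / (s - y) <= (D - w) / (s - D).
  rewrite ler_pdivrMr // mulrAC ler_pdivlMr // -subr_ge0.
  have -> : (D - w) * (s - y) - (y - w) * (s - D) = (D - y) * (s - w) by ring.
  by apply: mulr_ge0; lra.
apply: (le_trans h1).
have cp : 0 < c by lra.
rewrite -(ler_pM2l cp).
have -> : c * ((D - w) / (s - D)) = (D - w) * (c / (s - D)) by ring.
have T0 : 0 <= D / m by apply: divr_ge0; lra.
have -> : c * (l + k * w) =
  (D - w) * (l + k * (D - c)) + (w - (D - c)) * (l + k * D) by ring.
rewrite -[leLHS]addr0; apply: lerD; first by apply: ler_wpM2l => //; lra.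
by apply: mulr_ge0; [lra | apply: le_trans hT].
Qed.

(** If Q is below AT, the hull is AT. Otherwise AQ and QT meet at abscissa [D - c], and the sign of
    [D - 2 c] tells which of them covers [c]. *)
Lemma exists_dominating_line {R : realType} (s D m c : R) :
  0 < c <= D -> D < s -> 0 < m -> exists l k, dominating_line s D m c l k /\
  [\/ l + k * c <= chordAT s D m c,
      2 * c <= D /\ l + k * c <= c / (s - D)
    | D <= 2 * c /\ l + k * c <= chordQT s D m c].
Proof.
move=> /andP[c0 cD] Ds m0.
have Dp : 0 < D by lra.
have sD : 0 < s - D by lra.
have sc : 0 < s - c by lra.
have A0 : 0 <= c / (s - c) by apply: divr_ge0; lra.
have [D0 m1 sD0 sc0 cn] : [/\ D != 0, m != 0, s - D != 0, s - c != 0 & c != 0].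
  by split; rewrite gt_eqF.
(* is Q below the chord AT? *)
have [H|H] := leP (c / (s - D)) ((D - c) / m + c / (s - c) * (c / D)).
  exists (c / (s - c)), (1 / m - c / (s - c) / D); split; first split=> //.
  - suff -> : c / (s - c) + (1 / m - c / (s - c) / D) * (D - c) =
      (D - c) / m + c / (s - c) * (c / D) by [].
    by field; rewrite D0 sc0 m1.
  - by suff -> : c / (s - c) + (1 / m - c / (s - c) / D) * D = D / m by [];
      field; rewrite D0 sc0 m1.
  - constructor 1; rewrite le_eqVlt; apply/orP; left; apply/eqP.
    by rewrite /chordAT; field; rewrite D0 sc0 m1.
have [cD2|cD2] := leP (2 * c) D.
  (* The slope [sg] of AQ exceeds that of AT because Q is above AT, so the line AQ also passes above
     T. *)
  set A := c / (s - c) in A0 H *; set sg := c / ((s - c) * (s - D)).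
  have eQ : A + sg * (D - c) = c / (s - D).
    by rewrite /A /sg; field; rewrite sc0 sD0.
  exists A, sg; split; first split=> //.
  - by rewrite eQ.
  - have e : (D - c) / m + A * (c / D) = A + (1 / m - A / D) * (D - c).
      by field; rewrite D0 m1.
    move: H; rewrite e -eQ ltrD2l => H.
    have : 1 / m - A / D < sg by rewrite -(ltr_pM2r (_ : 0 < D - c)) //; lra.
    rewrite -(ltr_pM2r Dp).
    have -> : (1 / m - A / D) * D = D / m - A by field; rewrite D0 m1.
    lra.
  - constructor 2; split=> //.
    have -> : A + sg * c = c / (s - D) * ((s - D + c) / (s - c)).
      by rewrite /A /sg; field; rewrite sc0 sD0.
    rewrite -[leRHS]mulr1; apply: ler_wpM2l; first by apply: divr_ge0; lra.
    by rewrite ler_pdivrMr //; lra.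
set Q := c / (s - D) in H *.
(* The line QT; its excess over A is [D / c] times the excess of Q over AT. *)
exists (D / m - (D / m - Q) / c * D), ((D / m - Q) / c); split; first split.
- rewrite -subr_ge0.
  have -> : D / m - (D / m - Q) / c * D - c / (s - c) =
    (Q - ((D - c) / m + c / (s - c) * (c / D))) * (D / c).
    by field; rewrite cn m1 sc0 D0.
  by apply: mulr_ge0; [lra | apply: divr_ge0; lra].
- suff -> : D / m - (D / m - Q) / c * D + (D / m - Q) / c * (D - c) = Q by [].
  by field; rewrite cn m1.
- lra.
- constructor 3; split; first lra.
  rewrite le_eqVlt; apply/orP; left; apply/eqP.
  by rewrite /chordQT /Q; field; rewrite cn m1 sD0.
Qed.

(** * Replacing [c] by [t * c] *)

(** After division by [c], only [(D - c) / (s - c) = 1 - (s - D) / (s - c)] varies, and it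
    decreases. *)
Lemma chordAT_scale {R : realType} (s D m c t : R) :
  0 <= c <= D -> D < s -> 0 <= t <= 1 ->
  t * chordAT s D m c <= chordAT s D m (t * c).
Proof.
move=> /andP[c0 cD] Ds /andP[t0 t1].
have tc : t * c <= c by rewrite ler_piMl //; lra.
have -> : t * chordAT s D m c = t * c / m + (t * c) / D * ((D - c) / (s - c)).
  by rewrite /chordAT; ring.
have -> : chordAT s D m (t * c) =
    t * c / m + (t * c) / D * ((D - t * c) / (s - t * c)).
  by rewrite /chordAT; ring.
rewrite lerD2l; apply: ler_wpM2l.
  by apply: divr_ge0; [apply: mulr_ge0|]; lra.
set u := t * c in tc *.
have [su sc] : 0 < s - u /\ 0 < s - c by lra.
rewrite ler_pdivrMr // mulrAC ler_pdivlMr // -subr_ge0.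
have -> : (D - u) * (s - c) - (D - c) * (s - u) = (c - u) * (s - D) by ring.
by apply: mulr_ge0; lra.
Qed.

(** In the form [E], the last hypothesis makes the second factor nonpositive at [c]. Going down to
    [u] raises that factor and shrinks the nonnegative [2 - D / x], so the product does not
    decrease. *)
Lemma chordQT_scale {R : realType} (s D m c u : R) :
  0 < D -> D < s -> 0 < m -> D <= 2 * u -> u <= c -> D * (s - D) <= m * c ->
  u / c * chordQT s D m c <= chordQT s D m u.
Proof.
move=> D0 Ds m0 Du uc hc.
have u0 : 0 < u by lra.
have c0 : 0 < c by lra.
have sD : 0 < s - D by lra.
have [mn sDn cn un] : [/\ m != 0, s - D != 0, c != 0 & u != 0].
  by split; rewrite gt_eqF.
have E x : x != 0 -> chordQT s D m x =
    x * (1 / (s - D) + (2 - D / x) * (D / (m * x) - 1 / (s - D))).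
  by move=> xn; rewrite /chordQT; field; rewrite mn sDn xn.
rewrite !E // mulrA divfK // ler_pM2l // lerD2l.
have hx : D / c <= D / u by rewrite ler_pM2l // lef_pV2 ?posrE.
have hu2 : D / u <= 2 by rewrite ler_pdivrMr.
have hy : D / (m * c) <= D / (m * u).
  by rewrite ler_pM2l // lef_pV2 ?posrE ?mulr_gt0 // ler_pM2l.
have hc' : D / (m * c) <= 1 / (s - D).
  by rewrite ler_pdivrMr ?mulr_gt0 // mulrAC ler_pdivlMr // mul1r.
set x1 := D / c in hx *; set x2 := D / u in hx hu2 *.
set y1 := D / (m * c) in hy hc' *; set y2 := D / (m * u) in hy *.
rewrite -subr_ge0; set i := 1 / (s - D) in hc' *.
have -> : (2 - x2) * (y2 - i) - (2 - x1) * (y1 - i) =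
  (x2 - x1) * (i - y1) + (2 - x2) * (y2 - y1) by ring.
by apply: addr_ge0; apply: mulr_ge0; rewrite subr_ge0.
Qed.

(** By [1 + x <= e^x], the affine factor decays from [u] to [v] at exponential rate at most
    [b / (1 + b (s - v))], which is at most [1 / (s - D)] since [v <= D]. *)
Lemma tilt_le {R : realType} (b s D u v g : R) :
  0 <= b -> D < s -> u <= v <= D -> 1 / (s - D) <= g ->
  (1 + b * (s - u)) * expR (u * g) <= (1 + b * (s - v)) * expR (v * g).
Proof.
move=> b0 Ds /andP[uv vD] hg.
have sD : 0 < s - D by lra.
have Pv : 0 < 1 + b * (s - v) by apply: ltr_wpDr => //; apply: mulr_ge0 => //; lra.
have -> : v * g = (v - u) * g + u * g by ring.
rewrite expRD mulrA ler_pM2r ?expR_gt0 // [leRHS]mulrC -ler_pdivrMr //.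
have -> : (1 + b * (s - u)) / (1 + b * (s - v)) =
    1 + (v - u) * (b / (1 + b * (s - v))).
  by field; rewrite gt_eqF.
apply: (le_trans (expR_ge1Dx _)); rewrite ler_expR; apply: ler_wpM2l; first lra.
apply: le_trans hg; rewrite ler_pdivrMr // mulrAC ler_pdivlMr // -subr_ge0.
have -> : 1 * (1 + b * (s - v)) - b * (s - D) = 1 + b * (D - v) by ring.
by apply: addr_ge0 => //; apply: mulr_ge0 => //; lra.
Qed.

(** Meant for [c = W / N] and [t = N / (N + 1)]: the hull is built at [c], while the affine factor
    sees [t * c]. *)
Lemma exists_line_bounded {R : realType} (s D m b c t B : R) :
  0 <= c <= D -> D < s -> 0 < m -> 0 <= b -> 0 <= t <= 1 ->
  (forall u, 0 <= u <= D ->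
    (1 + b * (s - u)) * expR (chordAT s D m u) <= B) ->
  (forall u, 0 < u <= D -> D <= 2 * u ->
    (1 + b * (s - u)) * expR (chordQT s D m u) <= B) ->
  exists l k, dominating_line s D m c l k /\
    (1 + b * (s - t * c)) * expR (t * (l + k * c)) <= B.
Proof.
move=> /andP[c0 cD] Ds m0 b0 /andP[t0 t1] hAT hQT.
have [c_eq0|cn] := eqVneq c 0.
  exists 0, (1 / m); rewrite c_eq0; split.
    have d0 : 0 <= D / m by apply: divr_ge0; lra.
    have e : 1 / m * D = D / m by ring.
    by split; rewrite ?mul0r ?subr0 ?add0r ?e.
  have := hAT 0; rewrite /chordAT !(mul0r, mulr0, addr0); apply; lra.
have {cn}c0 : 0 < c by rewrite lt_neqAle eq_sym cn.
have tc : t * c <= c by rewrite ler_piMl // ltW.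
have tc0 : 0 <= t * c by rewrite mulr_ge0 // ltW.
have P0 : 0 <= 1 + b * (s - t * c).
  by apply: addr_ge0 => //; apply: mulr_ge0 => //; lra.
have sD : 0 < s - D by lra.
have [|l [k [hlk hc]]] := @exists_dominating_line R s D m c _ Ds m0.
  by rewrite c0.
exists l, k; split=> //.
have le_exp x y : x <= y -> (1 + b * (s - t * c)) * expR y <= B ->
    (1 + b * (s - t * c)) * expR x <= B.
  by move=> xy; apply: le_trans; rewrite ler_wpM2l // ler_expR.
(* At [u = D / 2], that is [p = 0] in [L2], [chordQT] equals [u / (s - D)]; tilting carries this
   bound to smaller abscissae. *)
have half : 2 * (t * c) <= D ->
    (1 + b * (s - t * c)) * expR (t * c * (1 / (s - D))) <= B.
  move=> tcD; apply: (le_trans (@tilt_le R b s D _ (D / 2) _ b0 Ds _ (lexx _))).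
    by apply/andP; split; lra.
  have := hQT (D / 2); rewrite /chordQT.
  have -> : 2 * (D / 2) - D = 0 by field.
  have -> : D / 2 * (1 / (s - D)) = D / m * (0 / (D / 2)) + (D - D / 2) / (s - D).
    by rewrite mul0r mulr0 add0r; field; rewrite gt_eqF.
  by apply; lra.
case: hc => [h|[cD2 h]|[cD2 h]].
- apply: (@le_exp _ (chordAT s D m (t * c))); last by apply: hAT; lra.
  apply: (@le_trans _ _ (t * chordAT s D m c)); first exact: ler_wpM2l.
  by apply: chordAT_scale; rewrite ?t0 ?(ltW c0).
- apply: (@le_exp _ (t * c * (1 / (s - D)))); last by apply: half; lra.
  by rewrite -mulrA mul1r; apply: ler_wpM2l.
- apply: (@le_exp _ (t * c * (chordQT s D m c / c))).
    have -> : t * c * (chordQT s D m c / c) = t * chordQT s D m c.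
      by field; rewrite gt_eqF.
    exact: ler_wpM2l.
  have qE : chordQT s D m c / c = 1 / (s - D) +
      (2 * c - D) / c * (D / (m * c) - 1 / (s - D)).
    by rewrite /chordQT; field; rewrite !gt_eqF.
  have x0 : 0 <= (2 * c - D) / c by apply: divr_ge0; lra.
  (* The test decides on which side of [1 / (s - D)] the ratio [chordQT c / c] lies. If it is above,
     tilting moves [t * c] up to [c]; if below, [half] or [chordQT_scale] applies. *)
  have [hc|hc] := leP (D * (s - D)) (m * c); last first.
    apply: le_trans (@tilt_le R b s D _ c _ b0 Ds _ _) _; first by rewrite tc.
      rewrite qE -[leLHS]addr0 lerD2l mulr_ge0 // subr_ge0.
      rewrite ler_pdivrMr // mulrAC ler_pdivlMr ?mulr_gt0 //.
      by rewrite mul1r ltW.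
    rewrite mulrC [c * _]mulrC divfK ?gt_eqF // mulrC.
    by apply: hQT; rewrite ?c0.
  have [tcD|tcD] := leP (2 * (t * c)) D.
    apply: le_exp (half tcD); apply: ler_wpM2l => //.
    rewrite qE -[leRHS]addr0 lerD2l mulr_ge0_le0 // subr_le0.
    rewrite ler_pdivrMr ?mulr_gt0 // mulrAC ler_pdivlMr //.
    by rewrite mul1r.
  apply: (@le_exp _ (chordQT s D m (t * c))); last by apply: hQT; lra.
  have -> : t * c * (chordQT s D m c / c) = t * c / c * chordQT s D m c.
    by ring.
  by apply: chordQT_scale => //; lra.
Qed.

(** * From [fJN], [L1] and [L2] to lines and chords *)

Lemma prod_le_expR_sum {R : realType} (N : nat) (A : {set 'I_N})
    (x e : 'I_N -> R) :
  (forall i, i \in A -> 0 <= x i <= 1 + e i) ->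
  0 <= \prod_(i in A) ((N%:R + x i) / (N%:R + 1)) <=
    expR ((\sum_(i in A) e i) / (N%:R + 1)).
Proof.
move=> hx; have n0 : 0 < N%:R + 1 :> R by rewrite natr1 ltr0n.
have f0 i : i \in A -> 0 <= (N%:R + x i) / (N%:R + 1).
  by move=> /hx /andP[x0 _]; rewrite divr_ge0 ?addr_ge0 // ltW.
rewrite prodr_ge0 //= mulr_suml expR_sum; apply: ler_prod => i iA.
rewrite f0 //=; apply: le_trans (expR_ge1Dx _).
rewrite ler_pdivrMr // mulrDl divfK ?gt_eqF // mul1r.
by have /andP[_ h] := hx i iA; lra.
Qed.

Lemma L1_chordAT {R : realType} (eps m M u : R) :
  0 < m -> M < 1 -> 0 < u <= M - m ->
  L1 eps m M (u / (M - m)) =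
  (1 + (expR eps - 1) * (1 - m - u)) * expR (chordAT (1 - m) (M - m) m u).
Proof.
move=> m0 M1 /andP[u0 uD].
have [Dn mn] : M - m != 0 /\ m != 0 by split; rewrite gt_eqF //; lra.
have hmean : u / (M - m) * M + (1 - u / (M - m)) * m = m + u by field.
rewrite /L1 hmean; congr (_ * expR _); first by ring.
by rewrite /chordAT; field; rewrite Dn mn !gt_eqF //; lra.
Qed.

(** This [p] makes [q = M - u], which is [m] plus the abscissa of Q, and gives mean [m + u]. It lies
    in [0, 1] exactly when [M - m <= 2 u]. *)
Lemma L2_chordQT {R : realType} (eps m M u : R) :
  0 < m -> M < 1 -> 0 < u <= M - m ->
  L2 eps m M (2 - (M - m) / u) =
  (1 + (expR eps - 1) * (1 - m - u)) * expR (chordQT (1 - m) (M - m) m u).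
Proof.
move=> m0 M1 /andP[u0 uD].
have [Dn mn un] : [/\ M - m != 0, m != 0 & u != 0].
  by split; rewrite gt_eqF //; lra.
have hq : (M + m - (2 - (M - m) / u) * M) / (2 - (2 - (M - m) / u)) = M - u.
  have -> : 2 - (2 - (M - m) / u) = (M - m) / u by ring.
  by field; rewrite un Dn.
rewrite /L2 hq; congr (_ * expR _); first by field.
by rewrite /chordQT; field; rewrite mn un !gt_eqF //; lra.
Qed.

Lemma sum_subr_const {R : realType} (N : nat) (a : 'I_N -> R) (m : R) :
  \sum_(j < N) (a j - m) = \sum_(j < N) a j - N%:R * m.
Proof. by rewrite sumrB sumr_const card_ord mulr_natl. Qed.

(** Each argument of the minimum yields one bound; shifted by [m], they are the constraints [y <= D]
    and [y <= w + c] of [dominating_lineP]. *)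
Lemma Mi_le {R : realType} (N : nat) (m M : R) (a : 'I_N -> R) (i : 'I_N) :
  (0 < N)%N -> m <= M -> m <= a i ->
  Mi m M a i <= M /\ Mi m M a i <= a i + (\sum_(j < N) (a j - m)) / N%:R.
Proof.
move=> N0 mM ma; have n1 : 1 <= N%:R :> R by rewrite ler1n.
have n0 : 0 < N%:R :> R by lra.
rewrite sum_subr_const /Mi.
set S := \sum_(j < N) a j; set n := N%:R in n0 n1 *; split.
  rewrite mulrC ler_pdivrMr // ge_min; apply/orP; left.
  rewrite -subr_ge0; have -> : M * n - (m + (n - 1) * M) = M - m by ring.
  by rewrite subr_ge0.
have -> : a i + (S - n * m) / n = n^-1 * (n * a i + S - n * m).
  by field; rewrite gt_eqF.
rewrite ler_pM2l ?invr_gt0 // ge_min; apply/orP; right; lra.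
Qed.

(* sup_N max_J max_a max_z f <= max_p max{L1 p, L2 p}, stated as: every f value
   is bounded by every upper bound B of {L1 p, L2 p : p in [0,1]}. *)
Theorem theorem5 (R : realType) (m M eps : R) :
  grid_mM m -> grid_mM M -> m <= M -> grid_eps eps ->
  forall B : R, (forall p : R, 0 <= p <= 1 -> L1 eps m M p <= B /\ L2 eps m M p <= B) ->
  forall (N : nat), (0 < N)%N ->
  forall (J : {set 'I_N}) (a z : 'I_N -> R),
    (forall i, m <= a i <= M) -> in_Pa m M a z ->
    fJN eps m J a z <= B.
Proof.
move=> gm gM mM geps B hB N N0 J a z ha [hz _].
have grid01 x : @grid_mM R x -> 0 < x < 1.
  case=> k [/andP[k1 k2] ->]; have := k1; have := k2.
  by rewrite -(ler_nat R) -[(1 <= k)%N](ler_nat R) => ? ?; lra.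
have /andP[m0 _] := grid01 _ gm; have /andP[_ M1] := grid01 _ gM.
have eps0 : 0 <= eps.
  by case: geps => [|[]] [k [_ ->]]; rewrite ?divr_ge0 // ler0n.
have b0 : 0 <= expR eps - 1 by have := expR_ge1Dx eps; lra.
have n1 : 1 <= N%:R :> R by rewrite ler1n.
have n0 : 0 < N%:R :> R by lra.
set W := \sum_(j < N) (a j - m).
have sumaE : \sum_(j < N) a j = N%:R * m + W.
  by rewrite /W sum_subr_const; ring.
have W0 : 0 <= W.
  by apply: sumr_ge0 => i _; have := ha i; lra.
have WD : W <= N%:R * (M - m).
  have -> : N%:R * (M - m) = \sum_(j < N) (M - m).
    by rewrite sumr_const card_ord mulr_natl.
  by apply: ler_sum => i _; have := ha i; lra.
set c := W / N%:R; set t := N%:R / (N%:R + 1) : R.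
have c0 : 0 <= c by rewrite divr_ge0 // ltW.
have cD : c <= M - m by rewrite ler_pdivrMr // mulrC.
have t01 : 0 <= t <= 1.
  by rewrite divr_ge0 ?ler_pdivrMr //; lra.
have [||||l [k [hlk hP]]] := @exists_line_bounded R (1 - m) (M - m) m
    (expR eps - 1) c t B _ _ m0 b0 t01.
- by rewrite c0.
- lra.
(* The case [u = 0] is [L1] at [p = 0], handled apart because [M - m] may vanish. *)
- move=> u /andP[u0 uD]; have [->|un] := eqVneq u 0.
    have [+ _] := hB 0 (introT andP (conj (lexx 0) ler01)); rewrite /L1 /chordAT !(mul0r, mulr0, add0r, addr0, subr0, mul1r).
    rewrite divff ?subrr ?gt_eqF //; last lra.
    suff -> : expR eps - (expR eps - 1) * m = 1 + (expR eps - 1) * (1 - m).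
      by [].
    by ring.
  have u1 : 0 < u by rewrite lt_neqAle eq_sym un.
  rewrite -L1_chordAT ?u1 //; apply: (hB _ _).1.
  by rewrite divr_ge0 ?ler_pdivrMr ?mul1r //; lra.
- move=> u /andP[u0 uD] Du; rewrite -L2_chordQT ?u0 //; apply: (hB _ _).2.
  rewrite subr_ge0 ler_pdivrMr // Du /= lerBlDr -lerBlDl.
  by rewrite ler_pdivlMr //; lra.
have hy i : 0 <= z i /\ z i <= M /\ z i - m <= a i - m + c.
  have /andP[hm hM] := hz i; have /andP[am aM] := ha i.
  by have [h1 h2] := @Mi_le R N m M a i N0 mM am; rewrite -/W -/c in h2; lra.
have line i : (a i - m) / m <= l + k * (a i - m) /\
    (z i - a i) / (1 - z i) <= l + k * (a i - m).
  have /andP[am aM] := ha i; have [z0 [zM zc]] := hy i.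
  have [|||h1 h2] := @dominating_lineP R (1 - m) (M - m) m c l k (a i - m) _ _ m0 hlk.
  - by rewrite c0.
  - lra.
  - by apply/andP; split; lra.
  split=> //.
  have := h2 (z i - m) _ zc.
  have -> : z i - m - (a i - m) = z i - a i by ring.
  have -> : 1 - m - (z i - m) = 1 - z i by ring.
  by apply; lra.
pose e i := l + k * (a i - m).
have hJ : forall i, i \in J -> 0 <= a i / z i <= 1 + e i.
  move=> i _; have /andP[am aM] := ha i; have /andP[zm _] := hz i.
  have [h _] := line i; rewrite divr_ge0 /=; [|lra..].
  apply: (@le_trans _ _ (a i / m)).
    rewrite ler_wpM2l ?lef_pV2 ?posrE //; lra.
  have -> : a i / m = 1 + (a i - m) / m by field; rewrite gt_eqF.
  by rewrite lerD2l.
have hJc : forall i, i \in ~: J -> 0 <= (1 - a i) / (1 - z i) <= 1 + e i.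
  move=> i _; have /andP[am aM] := ha i; have [z0 [zM _]] := hy i.
  have [_ h] := line i; rewrite divr_ge0 /=; [|lra..].
  have -> : (1 - a i) / (1 - z i) = 1 + (z i - a i) / (1 - z i).
    by field; rewrite gt_eqF //; lra.
  by rewrite lerD2l.
have /andP[p1 q1] := prod_le_expR_sum N J (fun i => a i / z i) e hJ.
have /andP[p2 q2] := prod_le_expR_sum N (~: J) (fun i => (1 - a i) / (1 - z i)) e hJc.
have tc : t * c = W / (N%:R + 1) by rewrite /t /c; field; rewrite !gt_eqF //; lra.
have tc1 : t * c <= 1 - m.
  by apply: (@le_trans _ _ (1 * c)); [rewrite ler_wpM2r //; case/andP: t01|lra].
(* The extra [m] in the numerator completes [N + 1] copies of [m], leaving [W / (N + 1)]. *)
have mean : (m + \sum_(i < N) a i) / (N%:R + 1) = m + t * c.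
  by rewrite sumaE tc; field; rewrite gt_eqF //; lra.
rewrite /fJN mean.
have -> : expR eps - (expR eps - 1) * (m + t * c) =
  1 + (expR eps - 1) * (1 - m - t * c) by ring.
apply: le_trans hP; rewrite -mulrA; apply: ler_wpM2l.
  by apply: addr_ge0 => //; apply: mulr_ge0 => //; lra.
apply: le_trans (ler_pM p1 p2 q1 q2) _.
rewrite -expRD -mulrDl ler_expR.
(* One affine bound serves both products, so the sum depends neither on [J] nor on [a] beyond
   [W]. *)
have -> : \sum_(i in J) e i + \sum_(i in ~: J) e i = N%:R * l + k * W.
  transitivity (\sum_i e i).
    rewrite [RHS](bigID (fun i => i \in J)) /=; congr (_ + _).
    by apply: eq_bigl => i; rewrite finset.in_setC.
  by rewrite big_split /= sumr_const card_ord -mulr_sumr mulr_natl.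
rewrite le_eqVlt; apply/orP; left; apply/eqP.
by rewrite /t /c; field; rewrite !gt_eqF //; lra.
Qed.
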